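(* Let $\mathcal{X}$ be a finite set and let $\{X_t\}_{t\ge 0}$ be a continuous-time Markov process on $\mathcal{X}$, killed by jumping to a cemetery state $\Delta\notin\mathcal{X}$ where it stays forever, with generator matrix $Q=((q_{xy}))_{x,y\in\mathcal{X}}$. Let $\eta$ be the number of transitions made before the transition to $\Delta$ (so the jump to $\Delta$ is the $(\eta+1)$-th transition). Assume that $Q^{-1}$ exists and that $\mathbf{P}_x(\eta<\infty)=1$ for all $x\in\mathcal{X}$. For $u \in\mathcal{X}$ let $l_\infty^u=\int_0^\infty 1_{\{X_s=u\}}\,ds$. Then for every $x\in\mathcal{X}$ and all real numbers $d_u\ge 0$, $u\in\mathcal{X}$, with $D$ the diagonal matrix with diagonal entries $\{d_u\}_{u\in\mathcal{X}}$, $$\mathbf{E}_x\left[e^{-\sum_{u\in\mathcal{X}}d_u l_\infty^u}\right]=\frac{|-Q|}{|D-Q|}\left(\sum_{y\in\mathcal{X}}\frac{|(D-Q)^{(x,y)}|}{|-Q|}\left(-\sum_{u\in\mathcal{X}}q_{yu}\right)\right).$$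
   Context: The generator $Q$ restricted to $\mathcal{X}$ satisfies $q_{xy}\ge 0$ for $x\ne y$ and $\sum_{u\in\mathcal{X}}q_{xu}\le 0$ for each $x$; the process at $x$ waits an exponential time with rate $-q_{xx}$, then jumps to $y\in\mathcal{X}\setminus\{x\}$ with probability $-q_{xy}/q_{xx}$ and to the cemetery $\Delta$ with probability $\left(-\sum_{u\in\mathcal{X}}q_{xu}\right)/(-q_{xx})$. $Q$ is not assumed reversible or symmetric. $\mathbf{P}_x$ and $\mathbf{E}_x$ denote probability and expectation for the process started at $x$. $|M|$ denotes the determinant of $M$. Fixing an ordering of $\mathcal{X}$, $|(D-Q)^{(x,y)}|$ denotes the signed minor: the determinant of the matrix obtained from $D-Q$ by removing the $y$-th row and the $x$-th column, multiplied by $-1$ if the positions of $x$ and $y$ in the ordering differ by an odd number (the determinant of an empty matrix being $1$). *)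

(* Defs.v *)
From mathcomp Require Import all_boot all_order all_algebra.
From mathcomp Require Import all_classical all_reals all_analysis.

Set Implicit Arguments.
Unset Strict Implicit.
Unset Printing Implicit Defensive.

Import Order.TTheory GRing.Theory Num.Theory.
Import numFieldNormedType.Exports.

Local Open Scope classical_set_scope.
Local Open Scope ring_scope.

(* The finite set of states, with its ordering, is 'I_n; the process takes its
   values in [option 'I_n], where [None] is the cemetery.  Only times t >= 0
   matter for a process [X : R -> T -> option 'I_n]. *)

Definition subMarkov_generator (R : realType) (n : nat) (Q : 'M[R]_n) : Prop :=
  (forall x y, x != y -> 0 <= Q x y) /\ (forall x, \sum_u Q x u <= 0).

Definition jump_rate (R : realType) (n : nat) (Q : 'M[R]_n)
    (a : option 'I_n) : R :=
  if a is Some x then - Q x x else 0.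

(* A state of rate 0 (in particular the cemetery) is absorbing. *)
Definition jump_prob (R : realType) (n : nat) (Q : 'M[R]_n)
    (a b : option 'I_n) : R :=
  if a is Some x then
    if Q x x == 0 then (b == a)%:R
    else if b is Some y then
      if y == x then 0 else - (Q x y / Q x x)
    else (- \sum_u Q x u) / (- Q x x)
  else (b == a)%:R.

Section paths.
Context {R : realType} {T : Type} {n : nat}.
Implicit Types (X : R -> T -> option 'I_n) (w : T).

(* +oo when the path is constant on [t, +oo[ *)
Definition next_jump X w (t : R) : \bar R :=
  ereal_inf [set s%:E | s in [set s : R | t < s /\ X s w <> X t w]].

Fixpoint jump_time X (k : nat) w : \bar R :=
  if k is k'.+1 then
    if jump_time X k' w is r%:E then next_jump X w r else +oo%E
  else 0%E.

(* Once there is no further jump, the jump chain keeps its last value. *)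
Fixpoint jump_chain X (k : nat) w : option 'I_n :=
  if k is k'.+1 then
    if jump_time X k'.+1 w is r%:E then X r w else jump_chain X k' w
  else X 0 w.

Definition holding_time X (k : nat) w : \bar R :=
  if jump_time X k w is r%:E then (jump_time X k.+1 w - r%:E)%E else +oo%E.

(* The number of transitions made before the transition to the cemetery:
   transition k.+1 leads from [jump_chain X k] to [jump_chain X k.+1]. *)
Definition transitions_before_death X w : \bar R :=
  ereal_inf [set (k%:R)%:E | k in [set k : nat | jump_chain X k.+1 w = None]].

Definition total_time X (u : 'I_n) w : \bar R :=
  (\int[@lebesgue_measure R]_(s in `[0%R, +oo[)
     (\1_[set s : R | X s w = Some u] s)%:E)%E.

End paths.

(* The process has right-continuous paths and, under [P x], it starts at x, its
   jump chain is Markov with transition matrix [jump_prob Q] and, given the jump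
   chain, the holding times are independent, the k-th one being exponential
   with the rate of the k-th state (almost surely infinite for rate 0). *)
Record is_killed_Markov_process (R : realType) (disp : measure_display)
    (T : measurableType disp) (n : nat) (Q : 'M[R]_n)
    (P : 'I_n -> probability T R) (X : R -> T -> option 'I_n) : Prop := {
  process_measurable : forall (t : R) (a : option 'I_n),
    0 <= t -> measurable [set w | X t w = a];
  process_right_continuous : forall (w : T) (t : R),
    0 <= t -> \forall s \near t^'+, X s w = X t w;
  process_law : forall (x : 'I_n) (m : nat) (a : nat -> option 'I_n)
      (t : nat -> R), (forall i, 0 <= t i) ->
    P x [set w | forall i, (i <= m)%N ->
           jump_chain X i w = a i /\ ((t i)%:E < holding_time X i w)%E] =
    ((a 0%N == Some x)%:R * (\prod_(i < m) jump_prob Q (a i) (a i.+1)) *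
     \prod_(i < m.+1) expR (- (jump_rate Q (a i) * t i)))%:E
}.

(* M^(x,y) removes row y and column x, so the indices of [cofactor] are
   exchanged. *)
Definition signed_minor (R : realType) (n : nat) (M : 'M[R]_n) (x y : 'I_n) : R :=
  cofactor M y x.

(* Main.v *)
Require Import Defs.
From mathcomp Require Import all_boot all_order all_algebra.
From mathcomp Require Import all_classical all_reals all_analysis.
From mathcomp Require Import measurable_realfun lra ring.

(** The jump chain and the holding times are measurable by right continuity, and
    [exp (- d h) = 1 - \int_0^h d exp (- d t) dt] turns the law of the holding
    times, given by its tails, into the factors
    [lambda / (lambda + d) = 1 - d / (lambda + d)] of their Laplace transforms.
    Let [h] solve [(D - Q) h = r] with [r_y = - \sum_u q_(yu)], and put [h = 1] at
    the cemetery.  Then the expectation of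
    [\prod_(i < m) exp (- d_(C_i) H_i) * h C_m], with [C] the jump chain and [H]
    the holding times, does not depend on [m]: it is [h x].  Almost surely the
    product is eventually equal to [exp (- \sum_u d_u l^u)], so by dominated
    convergence the expectation sought is [h x], which is Cramer's rule for
    [(D - Q) h = r]. *)

Set Implicit Arguments.
Unset Strict Implicit.
Unset Printing Implicit Defensive.

Import Order.TTheory GRing.Theory Num.Theory.
Import numFieldNormedType.Exports.

Local Open Scope classical_set_scope.
Local Open Scope ring_scope.

(** * Invertibility of [D - Q] *)

Lemma not_unitmx_kernel (R : realType) (n : nat) (A : 'M[R]_n) :
  A \notin unitmx -> exists2 v : 'rV[R]_n, v != 0 & v *m A = 0.
Proof.
rewrite -row_free_unit -kermx_eq0 => /rowV0Pn[v /sub_kermxP vA v0].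
by exists v.
Qed.

Lemma not_unitmx_cokernel (R : realType) (n : nat) (A : 'M[R]_n) :
  A \notin unitmx -> exists2 v : 'cV[R]_n, v != 0 & A *m v = 0.
Proof.
rewrite -unitmx_tr => /not_unitmx_kernel[v v0 vA].
exists v^T; first by rewrite trmx_eq0.
by apply: trmx_inj; rewrite trmx_mul trmxK vA trmx0.
Qed.

Section generator_algebra.
Context {R : realType} {n : nat} {Q : 'M[R]_n}.
Hypotheses (hQ : subMarkov_generator Q) (hinv : Q \in unitmx).

(** Otherwise row [x] would be nonnegative with sum at most 0, hence zero, against the invertibility
    of [Q]. *)
Lemma generator_diag_lt0 (x : 'I_n) : Q x x < 0.
Proof.
have [Qoff Qsum] := hQ.
rewrite ltNge; apply/negP => Qxx.
have Qx0 u : 0 <= Q x u.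
  by have [<-//|xu] := eqVneq x u; exact: Qoff.
have Q0 u : Q x u = 0.
  have := @psumr_eq0P _ _ xpredT (fun u => Q x u).
  by apply => //; apply/eqP; rewrite eq_le Qsum sumr_ge0.
have e0 : delta_mx 0 x *m Q = 0 :> 'rV_n.
  by rewrite -rowE; apply/rowP => u; rewrite !mxE.
have : delta_mx (0 : 'I_1) x *m Q *m invmx Q = 0 by rewrite e0 mul0mx.
rewrite mulmxK// => /matrixP/(_ 0 x); rewrite !mxE !eqxx => /eqP.
by rewrite oner_eq0.
Qed.

(* A null vector [v] of [D - Q] is of maximal modulus exactly on a set [S] that
   the process cannot leave and on which it is not killed.  Then [B], which is
   [Q] on the rows of [S] and the identity on the others, kills the indicator of
   [S]; a left null vector of [B] vanishes off [S] and is one of [Q]. *)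
Lemma resolvent_unitmx (d : 'I_n -> R) : (forall u, 0 <= d u) ->
  diag_mx (\row_u d u) - Q \in unitmx.
Proof.
move=> hd; have [Qoff Qsum] := hQ.
apply/negPn/negP => /not_unitmx_cokernel[v v0 Dv].
have [x0 vx0] : exists x0, v x0 0 != 0.
  apply/existsP; rewrite -negb_forall; apply: contra v0 => /forallP v0.
  by apply/eqP/colP => i; rewrite mxE; apply/eqP; exact: v0.
have [x1 _ x1max] := @Order.TotalTheory.arg_maxP _ _ _ x0 xpredT
  (fun i => `|v i 0|) isT.
set M := `|v x1 0| in x1max.
have M0 : 0 < M by rewrite (lt_le_trans _ (x1max x0 isT))// normr_gt0.
pose S := [set i | `|v i 0| == M]%SET.
have vle y : `|v y 0| <= M by exact: x1max.
have closed i : i \in S ->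
    \sum_u Q i u = 0 /\ forall y, y \notin S -> Q i y = 0.
  rewrite inE => /eqP viM.
  have vi : (d i - Q i i) * v i 0 = \sum_(y | y != i) Q i y * v y 0.
    have /matrixP/(_ i 0) := Dv.
    rewrite !mxE (bigD1 i)//= !mxE eqxx mulr1n => /eqP.
    rewrite addr_eq0 => /eqP ->; rewrite -sumrN; apply: eq_bigr => y yi.
    by rewrite !mxE eq_sym (negbTE yi) mulr0n sub0r mulNr opprK.
  have Qii : 0 <= - Q i i by rewrite oppr_ge0 ltW// generator_diag_lt0.
  (* Triangle inequality in row [i] of [(D - Q) v = 0], where [v i] has modulus [M]. *)
  have h1 : (d i - Q i i) * M <= \sum_(y | y != i) Q i y * `|v y 0|.
    rewrite -{1}viM -{1}(@ger0_norm _ (d i - Q i i)) ?addr_ge0// -normrM vi.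
    rewrite (le_trans (ler_norm_sum _ _ _))//; apply: ler_sum => y yi.
    by rewrite normrM ger0_norm// Qoff// eq_sym.
  have h2 : \sum_(y | y != i) Q i y * `|v y 0| <= \sum_(y | y != i) Q i y * M.
    apply: ler_sum => y yi; rewrite ler_wpM2l// ?Qoff//; by rewrite eq_sym.
  have h3 : \sum_(y | y != i) Q i y = \sum_u Q i u - Q i i.
    by rewrite [in RHS](bigD1 i)//= addrAC subrr add0r.
  rewrite -mulr_suml h3 in h2.
  (* Dividing by [M > 0] leaves [d i] at most the row sum of [Q]; as [d i >= 0] and the row sum is
     at most 0, it vanishes. *)
  have h4 := le_trans h1 h2; rewrite ler_pM2r// in h4.
  have sum0 : \sum_u Q i u = 0.
    by apply/eqP; rewrite eq_le Qsum/=; have := hd i; lra.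
  split=> // y yS; have yi : y != i.
    by apply: contraNneq yS => ->; rewrite inE viM.
  (* The two bounds above are equalities. The terms being nonnegative with sum 0, [Q i y] vanishes
     wherever [v y] has modulus less than [M]. *)
  have h5 : \sum_(y | y != i) Q i y * (M - `|v y 0|) = 0.
    apply/eqP; rewrite eq_le sumr_ge0 ?andbT; last first.
      by move=> z zi; rewrite mulr_ge0 ?subr_ge0// Qoff// eq_sym.
    under eq_bigr do rewrite mulrBr.
    rewrite sumrB -mulr_suml h3 sum0 sub0r subr_le0.
    by apply: le_trans h1; rewrite ler_wpM2r ?(ltW M0)// lerDr.
  have h6 z : z != i -> 0 <= Q i z * (M - `|v z 0|).
    by move=> zi; rewrite mulr_ge0 ?subr_ge0// Qoff// eq_sym.
  have /eqP := psumr_eq0P h6 h5 yi.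
  rewrite mulf_eq0 => /orP[/eqP//|].
  by rewrite subr_eq0 eq_sym => /eqP vyM; rewrite inE vyM eqxx in yS.
pose B : 'M[R]_n := \matrix_(i, j) (if i \in S then Q i j else (i == j)%:R).
have B1 : B *m (\col_i (i \in S)%:R : 'cV[R]_n) = 0.
  apply/colP => i; rewrite !mxE.
  under eq_bigr do rewrite !mxE.
  have [iS|iS] := boolP (i \in S).
    have [s0 off] := closed _ iS; rewrite -[RHS]s0; apply: eq_bigr => y _.
    have [yS|yS] := boolP (y \in S); first by rewrite mulr1.
    by rewrite mulr0 off.
  rewrite big1// => y _; have [<-|] := eqVneq i y; last by rewrite mul0r.
  by rewrite (negbTE iS) mulr0.
have : B \notin unitmx.
  apply/negP => Bu; have /(congr1 (mulmx (invmx B))) := B1.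
  rewrite mulKmx// mulmx0 => /colP/(_ x1); rewrite !mxE inE eqxx => /eqP.
  by rewrite oner_eq0.
move=> /not_unitmx_kernel[z z0 zB].
(* For [y] off [S], column [y] of [B] has the diagonal entry 1 and no other, since [Q i y = 0] for
   [i] in [S]. *)
have zoff y : y \notin S -> z 0 y = 0.
  move=> yS; have /rowP/(_ y) := zB; rewrite !mxE (bigD1 y)//= !mxE.
  rewrite (negbTE yS) eqxx mulr1 big1 ?addr0// => i iy; rewrite !mxE.
  have [iS|iS] := boolP (i \in S).
    by have [_ ->//] := closed _ iS; rewrite mulr0.
  by rewrite (negbTE iy) mulr0.
have zQ : z *m Q = 0.
  rewrite -zB; apply/rowP => y; rewrite !mxE; apply: eq_bigr => i _.
  rewrite mxE; have [//|iS] := boolP (i \in S).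
  by rewrite zoff// !mul0r.
have /(congr1 (mulmx^~ (invmx Q))) := zQ; rewrite mulmxK// mul0mx => z00.
by rewrite z00 eqxx in z0.
Qed.

End generator_algebra.

(** * Measurability of jump times and of the jump chain *)

Section right_continuous_paths.
Context {R : realType} {T : Type} {n : nat} {X : R -> T -> option 'I_n}.
Hypothesis hr : forall (w : T) (t : R), 0 <= t ->
  \forall s \near t^'+, X s w = X t w.

Lemma constant_on_right (w : T) (t : R) : 0 <= t ->
  exists2 e, 0 < e & forall s, t <= s < t + e -> X s w = X t w.
Proof.
move=> t0; have := hr w t0; rewrite near_withinE => /nbhs_ballP[e /= e0 He].
exists e => // s /andP[]; rewrite le_eqVlt => /orP[/eqP<-//|ts] se.
by apply: He => //; rewrite /ball/= ltr0_norm ?subr_lt0// opprB; lra.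
Qed.

Lemma next_jump_gt (w : T) (t : R) : 0 <= t -> (t%:E < next_jump X w t)%E.
Proof.
move=> t0; have [e e0 He] := constant_on_right w t0.
apply: (@lt_le_trans _ _ (t + e)%:E); first by rewrite lte_fin ltrDl.
apply: le_ereal_inf_tmp => _ [s [ts Xs] <-]; rewrite lee_fin leNgt.
by apply: contra_notN Xs => se; apply: He; rewrite se ltW.
Qed.

Lemma next_jump_constant (w : T) (t s : R) : t <= s ->
  (s%:E < next_jump X w t)%E -> X s w = X t w.
Proof.
rewrite le_eqVlt => /orP[/eqP<-//|ts] sJ; apply: contrapT => Xs.
have : (next_jump X w t <= s%:E)%E by apply: ereal_inf_lbound; exists s.
by rewrite leNgt sJ.
Qed.

(** A new value taken at [s] persists on some [[s, s + e[], which contains rationals, so countably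
    many times suffice. The absolute value keeps these times nonnegative, where the process is known
    to be measurable. *)
Lemma next_jump_lt_rat (w : T) (t : R) (c : \bar R) : 0 <= t ->
  (next_jump X w t < c)%E <->
  exists q : rat, [/\ t < `|ratr q|, (`|ratr q|%:E < c)%E &
                      X `|ratr q| w <> X t w].
Proof.
move=> t0; split=> [/ereal_inf_lt[_ [s [ts Xs] <-] sc]|[q [tq qc Xq]]]; last first.
  by apply: le_lt_trans qc; apply: ereal_inf_lbound; exists `|ratr q|.
have s0 : 0 <= s by rewrite (le_trans t0)// ltW.
have [e e0 He] := constant_on_right w s0.
have [r sr rc] : exists2 r, s < r & (r%:E <= c)%E.
  case: c sc => [c| |//]; rewrite ?lte_fin => sc; first by exists c.
  by exists (s + 1); rewrite ?ltrDl// leey.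
have [q] := @rat_in_itvoo _ s (Order.min r (s + e)) ltac:(by
  rewrite lt_min sr ltrDl e0).
rewrite in_itv/= lt_min => /and3P[sq qr qe].
exists q; rewrite gtr0_norm ?(le_lt_trans s0)//; split.
- exact: lt_trans sq.
- by apply: lt_le_trans rc; rewrite lte_fin.
- by rewrite He// ltW.
Qed.

Lemma jump_time_ge0 k w : (0 <= jump_time X k w)%E.
Proof.
elim: k => [//|k IH] /=; case: (jump_time X k w) IH => [r| |] //.
by rewrite lee_fin => r0; apply/ltW/(le_lt_trans _ (next_jump_gt w r0)).
Qed.

Lemma holding_time_gt0 k w : (0 < holding_time X k w)%E.
Proof.
rewrite /holding_time/=; have := jump_time_ge0 k w.
case: (jump_time X k w) => [r| |] //= r0.
by rewrite EFinN sube_gt0 next_jump_gt.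
Qed.

End right_continuous_paths.

Section measurability.
Context {R : realType} {disp : measure_display} {T : measurableType disp}.
Context {n : nat} {X : R -> T -> option 'I_n}.
Hypothesis hm : forall (t : R) (a : option 'I_n),
  0 <= t -> measurable [set w | X t w = a].
Hypothesis hr : forall (w : T) (t : R), 0 <= t ->
  \forall s \near t^'+, X s w = X t w.

(* By right continuity, [X (tau s) = a] iff [X q = a] for all rationals [q] in
   [tau s, tau s + 1 / (k + 1)[, for some [k]. *)
Lemma measurable_process_at d (S : measurableType d) (tau : S -> R)
    (pr : S -> T) (a : option 'I_n) :
  measurable_fun setT tau -> measurable_fun setT pr ->
  measurable [set s | 0 <= tau s /\ X (tau s) (pr s) = a].
Proof.
move=> mtau mpr.
have mle (f g : S -> R) : measurable_fun setT f -> measurable_fun setT g ->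
    measurable [set s | f s <= g s].
  move=> mf mg; rewrite -[X in measurable X]setTI.
  rewrite (_ : [set s | f s <= g s] = (fun s => f s <= g s) @^-1` [set true])//.
  by apply: (measurable_fun_ler mf mg).
pose ball_ k q := [set s | tau s < `|ratr q|] `&`
  [set s | `|ratr q| < tau s + k.+1%:R^-1] `&` [set s | X `|ratr q| (pr s) <> a].
have mlt (f g : S -> R) : measurable_fun setT f -> measurable_fun setT g ->
    measurable [set s | f s < g s].
  move=> mf mg; have -> : [set s | f s < g s] = ~` [set s | g s <= f s].
    by apply/seteqP; split=> s /=; rewrite ltNge => /negP.
  by apply: measurableC; exact: mle.
rewrite (_ : [set s | _] = [set s | 0 <= tau s] `&`
   \bigcup_(k in setT) ~` (\bigcup_(q : rat) ball_ k q)).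
  apply: measurableI; first exact: mle.
  apply: bigcupT_measurable => k; apply: measurableC.
  apply: bigcupT_measurable_rat => q; apply: measurableI.
    apply: measurableI; first exact: mlt.
    by apply: mlt => //; exact: measurable_funD.
  rewrite (_ : [set s | _] = pr @^-1` (~` [set w | X `|ratr q| w = a]))//.
  by rewrite -[X in measurable X]setTI; apply: mpr => //; exact/measurableC/hm.
apply/seteqP; split=> s /=.
- move=> [t0 Xa]; split=> //.
  have [e e0 He] := constant_on_right hr (pr s) t0.
  have [k] := ltr_add_invr e0; rewrite add0r => ke.
  exists k => // -[q _] [[/= tq qk] Xq]; apply: Xq; rewrite -Xa.
  by apply: He; rewrite ltW//= (lt_trans qk)// ltrD2l.
- move=> [t0 [k _ Hk]]; split=> //; apply: contrapT => Xa; apply: Hk.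
  have [e e0 He] := constant_on_right hr (pr s) t0.
  have [q] := @rat_in_itvoo _ (tau s) (tau s + Order.min e k.+1%:R^-1) ltac:(by
    rewrite ltrDl lt_min e0 invr_gt0 ltr0n).
  rewrite in_itv/= => /andP[tq qe].
  have q0 : 0 < ratr q :> R by exact: le_lt_trans tq.
  exists q => //; rewrite /ball_/= gtr0_norm//; split; [split=> //|].
    by rewrite (lt_le_trans qe)// lerD2l ge_min lexx orbT.
  by rewrite He// ltW//= (lt_le_trans qe)// lerD2l ge_min lexx.
Qed.

(** One induction serves both claims: the chain at [k.+1] is the process taken at the random time
    [jump_time X k.+1] if this is finite, and the chain at [k] otherwise. *)
Lemma measurable_jump k : measurable_fun setT (jump_time X k) /\
  forall a, measurable [set w | jump_chain X k w = a].
Proof.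
elim: k => [|k [mJ mC]].
  by split=> [|a]; [exact: measurable_cst|exact: hm].
(* [fine] sends an infinite jump time to 0, where [X] may still be evaluated; finiteness is imposed
   separately. *)
have mtau : measurable_fun setT (fun w => fine (jump_time X k w)).
  exact: measurableT_comp.
have t0 w : 0 <= fine (jump_time X k w) by rewrite fine_ge0// jump_time_ge0.
have mJ1 : measurable_fun setT (jump_time X k.+1).
  apply: (measurability _ (ErealGenInftyO.measurableE R)).
  move=> /= _ [_ [c ->]] <-; rewrite setTI.
  (* The next jump occurs before [c] iff some rational time between the current jump and [c] shows
     another value; that two values differ is expressed by a countable union over the value [a] of
     the first. *)
  rewrite (_ : _ @^-1` _ = [set w | jump_time X k w \is a fin_num] `&`
    \bigcup_(q : rat) ([set w | ((fine (jump_time X k w))%:E < `|ratr q|%:E)%E] `&`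
     [set w | (`|ratr q|%:E < c%:E)%E] `&`
     \bigcup_(a : option 'I_n) ([set w | X `|ratr q| w = a] `&`
       ~` [set w | 0 <= fine (jump_time X k w) /\
                   X (fine (jump_time X k w)) w = a]))).
    apply: measurableI.
      by rewrite -[X in measurable X]setTI; exact: emeasurable_fin_num.
    apply: bigcupT_measurable_rat => q; apply: measurableI; last first.
      apply: countable_bigcupT_measurable => [|a]; first exact: countableP.
      apply: measurableI; first exact: hm.
      by apply/measurableC/measurable_process_at.
    apply: measurableI.
      rewrite -[X in measurable X]setTI; apply: measurable_lte => //.
      exact/measurable_EFinP.
    rewrite (_ : [set w | _] = if (`|ratr q|%:E < c%:E)%E then setT else set0).
      by case: ifP.
    by apply/seteqP; split=> w /=; case: ifP.
  have nextP w : jump_time X k w \is a fin_num -> jump_time X k.+1 w =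
      next_jump X w (fine (jump_time X k w)).
    by rewrite /=; case: (jump_time X k w).
  apply/seteqP; split=> w; rewrite /preimage/= in_itv/=.
  - move=> Jc; have Jfin : jump_time X k w \is a fin_num.
      by have := jump_time_ge0 hr k w; case: (jump_time X k w) Jc.
    split=> //; have := nextP _ Jfin; rewrite /= => Je; rewrite Je in Jc.
    move/(next_jump_lt_rat hr _ _ (t0 w)) : Jc => [q [tq qc Xq]].
    exists q => //; split; first by split=> //=; rewrite lte_fin.
    by exists (X `|ratr q| w) => //; split=> //= -[_ /esym].
  - move=> [Jfin [q _ [[/= tq qc] [a _ [/= Xq Xt]]]]].
    have := nextP _ Jfin; rewrite /= => ->.
    apply/(next_jump_lt_rat hr _ _ (t0 w)); exists q; split=> //.
    by rewrite Xq => ae; apply: Xt.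
split=> // a.
have mtau1 : measurable_fun setT (fun w => fine (jump_time X k.+1 w)).
  exact: measurableT_comp.
have mfin : measurable [set w | jump_time X k.+1 w \is a fin_num].
  by rewrite -[X in measurable X]setTI; exact: emeasurable_fin_num.
rewrite (_ : [set w | _] =
   ([set w | jump_time X k.+1 w \is a fin_num] `&`
    [set w | 0 <= fine (jump_time X k.+1 w) /\
       X (fine (jump_time X k.+1 w)) w = a]) `|`
   ((~` [set w | jump_time X k.+1 w \is a fin_num]) `&`
    [set w | jump_chain X k w = a])).
  apply: measurableU; apply: measurableI => //.
  - exact: measurable_process_at.
  - exact: measurableC.
apply/seteqP; split=> w.
- have := jump_time_ge0 hr k.+1 w; rewrite /=.
  case: (jump_time X k w) => [r||] /=; [|by right|by right].
  case: (next_jump X w r) => [s||] //=; last by right.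
  by rewrite lee_fin => s0; left.
- rewrite /=; case: (jump_time X k w) => [r||]//=.
  + by case: (next_jump X w r) => [s||]//= [[]|[]]// _ [].
  + by move=> [[]|[]].
  + by move=> [[]|[]].
Qed.

Lemma measurable_jump_time k : measurable_fun setT (jump_time X k).
Proof. by have [] := measurable_jump k. Qed.

Lemma measurable_jump_chain k a : measurable [set w | jump_chain X k w = a].
Proof. by have [_] := measurable_jump k. Qed.

Lemma measurable_holding_time k : measurable_fun setT (holding_time X k).
Proof.
rewrite (_ : holding_time X k = fun w => if jump_time X k w \is a fin_num
  then (jump_time X k.+1 w - jump_time X k w)%E else +oo%E); last first.
  by apply/funext => w; rewrite /holding_time; case: (jump_time X k w).
apply: measurable_fun_ifT => //.
- apply: (measurable_fun_bool true).
  apply: emeasurable_fin_num => //; exact: measurable_jump_time.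
- by apply: emeasurable_funB; exact: measurable_jump_time.
Qed.

Lemma total_timeE u w :
  total_time X u w = lebesgue_measure [set s : R | 0 <= s /\ X s w = Some u].
Proof.
have mA : measurable [set s : R | 0 <= s /\ X s w = Some u].
  exact: (@measurable_process_at _ _ id (cst w)).
rewrite /total_time (_ : [set s : R | 0 <= s /\ X s w = Some u] =
  [set s : R | 0 <= s /\ X s w = Some u] `&` `[0%R, +oo[); last first.
  by apply/seteqP; split=> s /=; rewrite ?in_itv/= ?andbT; [case=> -> ->|case].
rewrite -integral_indic//; apply: eq_integral => s.
rewrite inE/= in_itv/= andbT => s0; rewrite !indicE; congr (_%:R)%:E; congr nat_of_bool.
by apply/idP/idP; rewrite !inE/=; [|case].
Qed.

(** The process is jointly measurable in path and time, and the total time is the measure of a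
    section of a measurable set of the product. *)
Lemma measurable_total_time u : measurable_fun setT (total_time X u).
Proof.
pose A := [set z : T * R | 0 <= z.2 /\ X z.2 z.1 = Some u].
have mA : measurable A by exact: measurable_process_at.
rewrite (_ : total_time X u = lebesgue_measure \o xsection A).
  exact: measurable_fun_xsection.
apply/funext => w; rewrite total_timeE/=; congr lebesgue_measure.
by apply/seteqP; split=> s; rewrite /xsection/= inE.
Qed.

End measurability.

(** * Laplace transforms of the holding times *)

(** By monotonicity and surjectivity onto [[0, +oo]], the preimage of a ray is a ray or the whole
    line. *)
Lemma measurable_expeR (R : realType) : measurable_fun setT (@expeR R).
Proof.
apply: (measurability _ (ErealGenOInfty.measurableE R)).
move=> /= _ [_ [c ->]] <-; rewrite setTI preimage_itvoy.
have [c0|c0] := ltP c 0.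
  rewrite (_ : [set x | _] = setT)//; apply/seteqP; split=> x //= _.
  by apply: lt_le_trans (expeR_ge0 _); rewrite lte_fin.
have [y yc] : exists y, expeR y = c%:E by apply: expeR_total; rewrite lee_fin.
rewrite (_ : [set x | _] = `]y, +oo[%classic); first exact: emeasurable_itv.
by apply/seteqP; split=> x /=; rewrite in_itv/= andbT -yc lte_expeR.
Qed.

(** For [h = +oo] this is 0 if [d > 0], but 1 if [d = 0], because [0 * +oo = 0]: an infinite stay in
    the cemetery, charged at rate 0, costs nothing. *)
Definition discount (R : realType) (d : R) (h : \bar R) : R :=
  fine (expeR (- (d%:E * h))%E).

Lemma measurable_lte_natr (R : realType) d (S : measurableType d)
    (f g : S -> \bar R) : measurable_fun setT f -> measurable_fun setT g ->
  measurable_fun setT (fun s => (f s < g s)%E%:R : R).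
Proof.
move=> mf mg; rewrite (_ : (fun s => _) = \1_[set s | (f s < g s)%E]).
  apply: measurable_indic; rewrite -[X in measurable X]setTI.
  exact: measurable_lte.
by apply/funext => s; rewrite indicE; congr (nat_of_bool _)%:R; apply/idP/idP;
  rewrite inE.
Qed.

Section discount.
Context {R : realType}.
Implicit Types (d lambda c : R) (h : \bar R).

Lemma discount_ge0 d h : 0 <= discount d h.
Proof. by rewrite fine_ge0// expeR_ge0. Qed.

Lemma discount_le1 d h : 0 <= d -> (0 <= h)%E -> discount d h <= 1.
Proof.
move=> d0 h0; have dh : (- (d%:E * h) <= 0)%E.
  by rewrite oppe_le0 mule_ge0// lee_fin.
rewrite /discount; case: (- _)%E dh => [r| |]//=.
by rewrite lee_fin -expR0 ler_expR.
Qed.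

Lemma discount0 h : discount 0 h = 1.
Proof. by rewrite /discount mul0e oppe0 expeR0. Qed.

Lemma measurable_discount d : measurable_fun setT (discount d).
Proof.
apply: measurableT_comp => //; apply: measurableT_comp.
  exact: measurable_expeR.
by apply: measurableT_comp => //; exact: measurable_funeM.
Qed.

(** The probability that an exponential clock of rate [d] rings before [h]. *)
Lemma integral_exponential_pdf_below d h : 0 < d -> (0 < h)%E ->
  (\int[lebesgue_measure]_t (exponential_pdf d t * (t%:E < h)%E%:R)%:E)%E =
  (1 - discount d h)%:E.
Proof.
move=> d0; case: h => [h| |//] h0; last first.
  rewrite -[RHS]/((1 - fine (expeR (- (d%:E * +oo))))%:E).
  rewrite gt0_muley ?lte_fin//= subr0 -(integral_exponential_pdf d0).
  by apply: eq_integral => t _; rewrite ltry mulr1.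
rewrite lte_fin in h0; rewrite /discount -EFinM -EFinN/=.
have := exponential_prob_itv0c d h0; rewrite mulNr -EFinB => <-.
rewrite /exponential_prob -integral_itv_bndo_bndc; last first.
  apply/measurable_EFinP; apply: measurable_funTS.
  exact: measurable_exponential_pdf.
rewrite [RHS]integral_mkcond; apply: eq_integral => t _.
rewrite patchE; case: ifPn; rewrite ?inE ?notin_setE/= in_itv/= lte_fin.
  by move=> /andP[_ ->]; rewrite mulr1.
move=> /negP; rewrite negb_and -ltNge => /orP[t0|/negbTE ->]; last by rewrite mulr0.
by rewrite lt0_exponential_pdf// mul0r.
Qed.

Context {disp : measure_display} {T : measurableType disp}.

(* [exp (- d h) = 1 - \int_0^h d exp (- d t) dt] turns the Laplace transform
   into an integral of tails. *)
Lemma laplace_of_exponential_tail (mu : {finite_measure set T -> \bar R})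
    (Y : T -> R) (H : T -> \bar R) c lambda d :
  measurable_fun setT Y -> (forall w, 0 <= Y w) ->
  measurable_fun setT H -> (forall w, (0 < H w)%E) ->
  0 <= lambda -> 0 <= d ->
  (forall t, 0 <= t -> (\int[mu]_w (Y w * (t%:E < H w)%E%:R)%:E)%E =
     (c * expR (- (lambda * t)))%:E) ->
  (\int[mu]_w (Y w * discount d (H w))%:E)%E =
  (c * (1 - d / (lambda + d)))%:E.
Proof.
move=> mY Y0 mH H0 l0 d0 hc.
have intY : (\int[mu]_w (Y w)%:E)%E = c%:E.
  rewrite -[c]mulr1 -expR0 -oppr0 -(mulr0 lambda) -hc//.
  by apply: eq_integral => w _; rewrite H0 mulr1.
have c0 : 0 <= c.
  by rewrite -lee_fin -intY; apply: integral_ge0 => w _; rewrite lee_fin.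
(* There is no exponential density of rate 0, so [d = 0] is treated apart; the quotient
   [d / (lambda + d)] is then 0 even if [lambda = 0]. *)
have [->|dn0] := eqVneq d 0.
  rewrite mul0r subr0 mulr1 -intY; apply: eq_integral => w _.
  by rewrite discount0 mulr1.
have {}d0 : 0 < d by rewrite lt_neqAle eq_sym dn0.
have ld0 : 0 < lambda + d by rewrite ltr_wpDl.
have mD : measurable_fun setT (fun w => discount d (H w)).
  exact: measurableT_comp (@measurable_discount d) mH.
have disc1 w : 0 <= 1 - discount d (H w).
  by rewrite subr_ge0 discount_le1// ltW.
(* Tonelli's theorem is applied to [f]: integrating over time first produces
   [Y * (1 - discount d H)], integrating over [T] first uses the tails. *)
pose f (z : T * R) :=
  (Y z.1 * (exponential_pdf d z.2 * (z.2%:E < H z.1)%E%:R))%:E.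
have mf : measurable_fun setT f.
  apply/measurable_EFinP; apply: measurable_funM; first exact: measurableT_comp.
  apply: measurable_funM.
    exact: measurableT_comp (measurable_exponential_pdf d) _.
  apply: measurable_lte_natr; last exact: measurableT_comp.
  by apply/measurable_EFinP.
have f0 z : (0 <= f z)%E.
  rewrite lee_fin; apply: mulr_ge0 => //; apply: mulr_ge0 => //.
  exact/exponential_pdf_ge0/ltW.
have := @fubini_tonelli _ _ _ _ _ mu lebesgue_measure f mf f0.
have -> : (\int[mu]_w \int[lebesgue_measure]_t f (w, t) =
           \int[mu]_w (Y w * (1 - discount d (H w)))%:E)%E.
  apply: eq_integral => w _; rewrite EFinM -integral_exponential_pdf_below//.
  rewrite -ge0_integralZl_EFin//.
  - move=> t _; rewrite lee_fin; apply: mulr_ge0 => //.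
    exact/exponential_pdf_ge0/ltW.
  - apply/measurable_EFinP; apply: measurable_funM.
      exact: measurable_exponential_pdf.
    by apply: measurable_lte_natr => //; exact/measurable_EFinP.
have -> : (\int[lebesgue_measure]_t \int[mu]_w f (w, t) =
           (c * (d / (lambda + d)))%:E)%E.
  (* The density of rate [d] times the tail of rate [lambda] is [d / (lambda + d)] times the density
     of rate [lambda + d]. *)
  transitivity (\int[lebesgue_measure]_t
      ((c * (d / (lambda + d)))%:E * (exponential_pdf (lambda + d) t)%:E))%E.
    apply: eq_integral => t _; have [t0|t0] := leP 0 t; last first.
      have pdf0 r : exponential_pdf r t = 0 by exact: lt0_exponential_pdf.
      rewrite pdf0 mule0 integral0_eq// => w _.
      by rewrite /f/= pdf0 mul0r mulr0.
    rewrite !exponential_pdfE//.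
    transitivity (\int[mu]_w ((d * expR (- d * t))%:E *
       (Y w * (t%:E < H w)%E%:R)%:E))%E.
      by apply: eq_integral => w _; rewrite -EFinM /f/= exponential_pdfE// mulrCA.
    rewrite ge0_integralZl_EFin//; last 3 first.
      - by move=> w _; rewrite lee_fin mulr_ge0.
      - apply/measurable_EFinP; apply: measurable_funM => //.
        exact: measurable_lte_natr.
      - by apply: mulr_ge0; [exact: ltW|exact: expR_ge0].
    rewrite hc// -!EFinM; congr EFin; rewrite !mulNr.
    have -> : expR (- ((lambda + d) * t)) =
              expR (- (lambda * t)) * expR (- (d * t)).
      by rewrite -expRD; congr expR; ring.
    by field; rewrite gt_eqF.
  rewrite ge0_integralZl_EFin ?integral_exponential_pdf ?mule1//.
  - by move=> t _; rewrite lee_fin exponential_pdf_ge0// ltW.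
  - by apply/measurable_EFinP; exact: measurable_exponential_pdf.
  - by rewrite mulr_ge0// divr_ge0// ltW.
(* The two integrals add up to [c], and the second one is finite, so it can be subtracted. *)
move=> e; have : (\int[mu]_w (Y w * discount d (H w))%:E +
   \int[mu]_w (Y w * (1 - discount d (H w)))%:E = c%:E)%E.
  rewrite -ge0_integralD//; last 4 first.
  - by move=> w _; rewrite lee_fin mulr_ge0// discount_ge0.
  - by apply/measurable_EFinP; exact: measurable_funM.
  - by move=> w _; rewrite lee_fin mulr_ge0.
  - by apply/measurable_EFinP; apply: measurable_funM => //; exact: measurable_funB.
  by rewrite -intY; apply: eq_integral => w _; rewrite -EFinD; congr EFin; ring.
rewrite e; case: (\int[mu]_w _)%E => [r| |]//.
by move=> [rc]; congr EFin; rewrite mulrBr mulr1 -{1}rc addrK.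
Qed.

End discount.

(** * Occupation times of an absorbed path *)

Section lifetime.
Context {R : realType} {disp : measure_display} {T : measurableType disp}.
Context {n : nat} {X : R -> T -> option 'I_n}.
Hypothesis hm : forall (t : R) (a : option 'I_n),
  0 <= t -> measurable [set w | X t w = a].
Hypothesis hr : forall (w : T) (t : R), 0 <= t ->
  \forall s \near t^'+, X s w = X t w.

Lemma jump_time_fin_ind k w :
  jump_time X k.+1 w \is a fin_num -> jump_time X k w \is a fin_num.
Proof. by rewrite /=; case: (jump_time X k w). Qed.

Lemma jump_time_fin_le i k w : (i <= k)%N ->
  jump_time X k w \is a fin_num -> jump_time X i w \is a fin_num.
Proof.
elim: k => [|k IH]; first by rewrite leqn0 => /eqP->.
by rewrite leq_eqVlt => /orP[/eqP->//|ik] /jump_time_fin_ind; exact: IH.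
Qed.

Lemma jump_chain_jump_time k w : jump_time X k w \is a fin_num ->
  jump_chain X k w = X (fine (jump_time X k w)) w.
Proof.
case: k => [//|k] /=; case: (jump_time X k w) => [r||]//.
by case: (next_jump X w r).
Qed.

Lemma jump_timeS k w : jump_time X k w \is a fin_num ->
  jump_time X k.+1 w = next_jump X w (fine (jump_time X k w)).
Proof. by rewrite /=; case: (jump_time X k w). Qed.

Lemma holding_timeE k w : jump_time X k.+1 w \is a fin_num ->
  holding_time X k w =
  (fine (jump_time X k.+1 w) - fine (jump_time X k w))%:E.
Proof.
move=> f1; have f0 := jump_time_fin_ind f1.
rewrite /holding_time EFinB (fineK f1) (fineK f0).
by case: (jump_time X k w) f0.
Qed.

(** The chain keeps its value when there is no further jump, so the index can be lowered until its
    jump time is finite. *)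
Lemma first_death k w : jump_chain X k w = None ->
  exists K, jump_chain X K w = None /\ jump_time X K w \is a fin_num.
Proof.
elim: k => [|k IH]; first by exists 0%N.
have [f1 e|] := boolP (jump_time X k.+1 w \is a fin_num).
  by exists k.+1.
have := jump_time_ge0 hr k.+1 w => /= J0 nf.
have Joo : (if jump_time X k w is r%:E then next_jump X w r else +oo)%E = +oo%E.
  by move: J0 nf; case: (X in (0 <= X)%E -> _).
by rewrite Joo; exact: IH.
Qed.

Lemma absorbed_jump_chain K w : jump_time X K w \is a fin_num ->
  holding_time X K w = +oo%E ->
  forall m, (K <= m)%N -> jump_chain X m w = jump_chain X K w.
Proof.
move=> fK HK.
have J1 : jump_time X K.+1 w = +oo%E.
  move: HK; rewrite /holding_time; rewrite /=.
  by case: (jump_time X K w) fK => [r||]//= _; case: (next_jump X w r).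
have Jm m : (K < m)%N -> jump_time X m w = +oo%E.
  elim: m => [//|m IH]; rewrite ltnS leq_eqVlt => /orP[/eqP<-//|/IH] /= -> //.
elim=> [|m IH]; first by rewrite leqn0 => /eqP->.
rewrite leq_eqVlt => /orP[/eqP->//|Km]; rewrite -IH//.
by have := Jm m.+1 Km; rewrite /= => ->.
Qed.

(** Between two successive jump times the path is constant, equal to the chain; the interval counts
    in full or not at all. *)
Lemma occupation_before_jump u K w : jump_time X K w \is a fin_num ->
  lebesgue_measure
    [set s : R | 0 <= s < fine (jump_time X K w) /\ X s w = Some u] =
  (\sum_(i < K) (jump_chain X i w == Some u)%:R *
     fine (holding_time X i w))%:E.
Proof.
elim: K => [|K IH] fK.
  rewrite big_ord0 (_ : [set _ | _] = set0) ?measure0//.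
  by apply/seteqP; split=> s //= [/andP[s0 s1] _]; lra.
have f0 := jump_time_fin_ind fK.
set r := fine (jump_time X K w) in IH *.
set r' := fine (jump_time X K.+1 w).
have r0 : 0 <= r by rewrite fine_ge0// jump_time_ge0.
have Jr' : next_jump X w r = r'%:E by rewrite fineK// jump_timeS.
have rr' : r < r' by rewrite -lte_fin -Jr' next_jump_gt.
have mi : lebesgue_measure (`[r, r'[%classic : set R) = (r' - r)%:E.
  by rewrite lebesgue_measure_itv/= lte_fin rr'.
rewrite big_ord_recr/= EFinD -IH//.
rewrite (_ : [set s | _] =
  [set s | 0 <= s < r /\ X s w = Some u] `|`
  (if jump_chain X K w == Some u then `[r, r'[%classic else set0)).
  rewrite measureU.
  - congr (_ + _)%E; case: ifP => _; last by rewrite measure0 mul0r.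
    by rewrite mul1r holding_timeE//; exact: mi.
  - rewrite (_ : [set _ | _] =
      [set s | 0 <= s /\ X s w = Some u] `&` `]-oo, r[%classic).
      apply: measurableI => //.
      exact: (measurable_process_at hm hr (tau := id) (pr := cst w)).
    apply/seteqP; split=> s; rewrite /= in_itv/=.
      by move=> [/andP[-> ->]].
    by move=> [[-> ->] ->].
  - by case: ifP.
  - apply/seteqP; split=> s //=; case: ifP => _; last by case.
    move=> [[/andP[_ sr] _]].
    by rewrite /= in_itv/= leNgt sr.
apply/seteqP; split=> s /=.
- move=> [/andP[s0 sr'] Xs]; have [sr|rs] := ltP s r; first by left; rewrite s0.
  right; rewrite jump_chain_jump_time// -/r.
  have -> : X r w = Some u.
    by rewrite -Xs; apply/esym/next_jump_constant; rewrite // Jr' lte_fin.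
  by rewrite eqxx/= in_itv/= rs.
- move=> [[/andP[-> sr] ->]|]; first by rewrite (lt_trans sr).
  case: ifP => //= /eqP Cu; rewrite in_itv/= => /andP[rs sr'].
  rewrite sr' (le_trans r0 rs) -Cu jump_chain_jump_time// -/r; split=> //.
  by apply: next_jump_constant; rewrite // Jr' lte_fin.
Qed.

Lemma total_time_absorbed u K w : jump_time X K w \is a fin_num ->
  jump_chain X K w = None -> holding_time X K w = +oo%E ->
  total_time X u w = (\sum_(i < K) (jump_chain X i w == Some u)%:R *
     fine (holding_time X i w))%:E.
Proof.
move=> fK CK HK; rewrite (total_timeE hm hr) -occupation_before_jump//.
congr lebesgue_measure; apply/seteqP; split=> s /=; last first.
  by move=> [/andP[-> _]].
move=> [s0 Xs]; rewrite s0 ltNge; split=> //; apply/negP => rs.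
have : X s w = X (fine (jump_time X K w)) w.
  apply: next_jump_constant => //.
  rewrite -jump_timeS//; move: HK; rewrite /holding_time /=.
  case: (jump_time X K w) fK => [r||]//= _.
  by case: (next_jump X w r) => //= _; rewrite ltry.
by rewrite -jump_chain_jump_time// CK Xs.
Qed.

(** Exchanging the sums groups the exponent by transitions instead of states; in each transition
    only the current state of the chain contributes. *)
Lemma discounted_lifetime (d : 'I_n -> R) K w :
  jump_time X K w \is a fin_num ->
  jump_chain X K w = None -> holding_time X K w = +oo%E ->
  fine (expeR (- \sum_(u < n) (d u)%:E * total_time X u w)%E) =
  \prod_(i < K) discount (oapp d 0 (jump_chain X i w)) (holding_time X i w).
Proof.
move=> fK CK HK.
have e u : ((d u)%:E * total_time X u w)%E = (\sum_(i < K)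
    d u * ((jump_chain X i w == Some u)%:R * fine (holding_time X i w)))%:E.
  by rewrite (total_time_absorbed u fK CK HK) -EFinM mulr_sumr.
under eq_bigr do rewrite e.
rewrite sumEFin exchange_big/= -sumrN expR_sum; apply: eq_bigr => i _.
have fi : jump_time X i.+1 w \is a fin_num by apply: jump_time_fin_le fK.
rewrite /discount holding_timeE// -EFinM -EFinN/=; congr (expR (- _)).
case: (jump_chain X i w) => [v|]/=; last first.
  by rewrite big1 ?mul0r// => u _; rewrite mulr0.
rewrite (bigD1 v)//= eqxx mul1r big1 ?addr0// => u uv.
by rewrite (inj_eq Some_inj) eq_sym (negbTE uv) mul0r mulr0.
Qed.

End lifetime.

(** * Expectations along the jump chain *)

Lemma prod_boolr (R : realType) m (b : 'I_m -> bool) :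
  \prod_(i < m) (b i)%:R = [forall i, b i]%:R :> R.
Proof.
have [/forallP bi|] := boolP [forall i, b i].
  by rewrite big1// => i _; rewrite bi.
rewrite negb_forall => /existsP[i /negbTE bi].
by rewrite (bigD1 i)//= bi mul0r.
Qed.

Lemma sum_indic_eq (R : realType) (I : finType) (F : I -> R) (i : I) :
  \sum_j F j * (i == j)%:R = F i.
Proof.
rewrite (bigD1 i)//= eqxx mulr1 big1 ?addr0// => j ji.
by rewrite eq_sym (negbTE ji) mulr0.
Qed.

Lemma bounded_integrable_prob (R : realType) disp (T : measurableType disp)
    (mu : probability T R) (f : T -> R) (M : R) :
  measurable_fun setT f -> (forall w, `|f w| <= M) ->
  mu.-integrable setT (EFin \o f).
Proof.
move=> mf fM; apply: measurable_bounded_integrable => //.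
  by apply: le_lt_trans (ltry 1); exact: probability_le1.
exists M; split; first exact: num_real.
by move=> M' MM' w _ /=; rewrite (le_trans (fM w))// ltW.
Qed.

Section killed_process.
Context {R : realType} {n : nat} {Q : 'M[R]_n}.
Context {disp : measure_display} {T : measurableType disp}.
Context {P : 'I_n -> probability T R} {X : R -> T -> option 'I_n}.
Hypotheses (hQ : subMarkov_generator Q) (hX : is_killed_Markov_process Q P X).

Let hm := process_measurable hX.
Let hr := process_right_continuous hX.

Lemma jump_rate_ge0 a : 0 <= jump_rate Q a.
Proof.
case: a => //= x; have [Qoff Qsum] := hQ.
rewrite oppr_ge0; apply: le_trans (Qsum x).
rewrite (bigD1 x)//= lerDl sumr_ge0// => u ux.
by rewrite Qoff// eq_sym.
Qed.

Lemma measurable_chain_indic k a :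
  measurable_fun setT (fun w => (jump_chain X k w == a)%:R : R).
Proof.
rewrite (_ : (fun w => _) = \1_[set w | jump_chain X k w = a]).
  exact/measurable_indic/measurable_jump_chain.
apply/funext => w; rewrite indicE; congr (nat_of_bool _)%:R.
by apply/eqP/idP; rewrite inE.
Qed.

Lemma measurable_discount_holding d k :
  measurable_fun setT (fun w => discount d (holding_time X k w)).
Proof.
apply: measurableT_comp; first exact: measurable_discount.
exact: measurable_holding_time.
Qed.

Lemma discount_holding_ge0_le1 d k w : 0 <= d ->
  0 <= discount d (holding_time X k w) <= 1.
Proof.
by move=> d0; rewrite discount_ge0 discount_le1// ltW// holding_time_gt0.
Qed.

(** * Joint law of the jump chain and the discounted holding times *)

(** Interpolates between the tails given by the law of the process ([j = 0]) and the fully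
    discounted path ([j = m.+1]). *)
Let factor (j : nat) (dl t : nat -> R) (a : nat -> option 'I_n) (i : nat) w : R :=
  (if (i < j)%N then discount (dl i) (holding_time X i w)
   else ((t i)%:E < holding_time X i w)%E%:R) * (jump_chain X i w == a i)%:R.

Let mfactor j dl t a i : measurable_fun setT (factor j dl t a i).
Proof.
rewrite /factor; apply: measurable_funM; last exact: measurable_chain_indic.
case: (i < j)%N; first exact: measurable_discount_holding.
by apply: measurable_lte_natr => //; exact: measurable_holding_time.
Qed.

Let factor_ge0 j dl t a i w : 0 <= factor j dl t a i w.
Proof. by rewrite mulr_ge0//; case: ifP; rewrite ?discount_ge0. Qed.

Let path_prob (x : 'I_n) m (a : nat -> option 'I_n) : R :=
  (a 0%N == Some x)%:R * \prod_(i < m) jump_prob Q (a i) (a i.+1).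

Let joint_law x m a t : (forall i, 0 <= t i) ->
  (\int[P x]_w (\prod_(i < m.+1) factor 0 (fun=> 0) t a i w)%:E)%E =
  (path_prob x m a *
   \prod_(i < m.+1) expR (- (jump_rate Q (a i) * t i)))%:E.
Proof.
move=> t0; rewrite -(process_law hX x m a t0).
pose A := [set w | forall i, (i <= m)%N ->
  jump_chain X i w = a i /\ ((t i)%:E < holding_time X i w)%E].
rewrite -[RHS]/(P x A).
have mA : measurable A.
  rewrite (_ : A = \bigcap_(i in [set i | (i <= m)%N])
     ([set w | jump_chain X i w = a i] `&`
      [set w | ((t i)%:E < holding_time X i w)%E])).
    apply: bigcap_measurableType => i _; apply: measurableI.
      exact: measurable_jump_chain.
    rewrite -[X in measurable X]setTI; apply: measurable_lte => //.
    exact: measurable_holding_time.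
  by apply/seteqP; split=> w /= wA i im; exact: wA.
rewrite -[A in RHS]setIT -integral_indic//; apply: eq_integral => w _.
congr EFin; rewrite indicE big_split/= !prod_boolr -natrM mulnb.
congr (nat_of_bool _)%:R; apply/andP/idP.
  move=> [/forallP h1 /forallP h2]; rewrite inE => i im.
  pose oi : 'I_m.+1 := Ordinal (im : (i < m.+1)%N).
  by split; [exact/eqP/(h2 oi)|exact: (h1 oi)].
rewrite inE => wA; split; apply/forallP => i.
  by have [] := wA i (ltn_ord i).
by apply/eqP; have [] := wA i (ltn_ord i).
Qed.

(* The tails of the holding times are replaced by Laplace transforms one at a
   time, from left to right. *)
Let mixed_law x m a dl j t : (j <= m.+1)%N ->
  (forall i, 0 <= dl i) -> (forall i, 0 <= t i) ->
  (\int[P x]_w (\prod_(i < m.+1) factor j dl t a i w)%:E)%E =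
  (path_prob x m a * \prod_(i < m.+1)
     (if (i < j)%N then 1 - dl i / (jump_rate Q (a i) + dl i)
      else expR (- (jump_rate Q (a i) * t i))))%:E.
Proof.
move=> + dl0; elim: j t => [|j IH] t jm t0.
  rewrite -joint_law//.
pose oj : 'I_m.+1 := Ordinal jm.
(* [Y] gathers everything but the factor of the [j]-th holding time, and [c] is its expectation. *)
pose Y w := (\prod_(i < m.+1 | i != oj) factor j dl t a i w) *
            (jump_chain X j w == a j)%:R.
pose c := path_prob x m a * \prod_(i < m.+1 | i != oj)
     (if (i < j)%N then 1 - dl i / (jump_rate Q (a i) + dl i)
      else expR (- (jump_rate Q (a i) * t i))).
have neqj (i : 'I_m.+1) : i != oj -> (i == j :> nat) = false.
  by move=> ij; apply/negbTE; apply: contra ij => /eqP e; apply/eqP/val_inj.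
have ltj (i : 'I_m.+1) : i != oj -> (i < j.+1)%N = (i < j)%N.
  by move=> ij; rewrite ltnS leq_eqVlt neqj.
transitivity (\int[P x]_w (Y w * discount (dl j) (holding_time X j w))%:E)%E.
  apply: eq_integral => w _; congr EFin.
  rewrite (bigD1 oj)//= (eq_bigr (fun i => factor j dl t a (val i) w)).
    by rewrite {1}/factor ltnSn /Y; set p := \prod_(_ | _) _; ring.
  by move=> i ij; rewrite /factor ltj.
rewrite (@laplace_of_exponential_tail _ _ _ (P x) Y _ c (jump_rate Q (a j)))//.
- rewrite /c [in RHS](bigD1 oj)//= ltnSn -mulrA; congr (_ * _)%:E.
  by rewrite mulrC; congr (_ * _); apply: eq_bigr => i ij; rewrite ltj.
- rewrite /Y; apply: measurable_funM; last exact: measurable_chain_indic.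
  by under eq_fun do rewrite -big_filter; apply: measurable_prod.
- by move=> w; rewrite mulr_ge0// prodr_ge0.
- exact: measurable_holding_time.
- by move=> w; exact: holding_time_gt0.
- exact: jump_rate_ge0.
(* The induction hypothesis with [j]-th threshold [s] is the exponential tail required. *)
- move=> s s0; pose t' i := if i == j then s else t i.
  have t'0 i : 0 <= t' i by rewrite /t'; case: ifP.
  have t'n (i : 'I_m.+1) : i != oj -> t' i = t i.
    by move=> ij; rewrite /t' neqj.
  have := IH t' (ltnW jm) t'0.
  rewrite [in X in _ = X -> _](bigD1 oj)//= ltnn [t' j]/t' eqxx.
  rewrite [X in path_prob _ _ _ * (_ * X)](eq_bigr (fun i : 'I_m.+1 =>
    if (i < j)%N then 1 - dl i / (jump_rate Q (a i) + dl i)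
      else expR (- (jump_rate Q (a i) * t i)))); last first.
    by move=> i ij; rewrite t'n.
  rewrite mulrCA [_ * (path_prob _ _ _ * _)]mulrC => <-.
  apply: eq_integral => w _; congr EFin; rewrite [RHS](bigD1 oj)//=.
  rewrite [in RHS](eq_bigr (fun i => factor j dl t a (val i) w)).
    by rewrite {1}/factor/= ltnn /t' eqxx /Y; set p := \prod_(_ | _) _; ring.
  by move=> i ij; rewrite /factor t'n.
Qed.

(** The rates are attached to steps, not states, so that a chosen holding time can be discounted
    alone or left out. *)
Definition discounted_path m (dl : nat -> R) (a : nat -> option 'I_n) w : R :=
  \prod_(i < m.+1) discount (dl i) (holding_time X i w) *
  \prod_(i < m.+1) (jump_chain X i w == a i)%:R.

(** The form [1 - d / (lambda + d)] gives the correct value 1 when both rates are 0, where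
    [lambda / (lambda + d)] would give 0. *)
Definition discounted_path_prob (x : 'I_n) m (dl : nat -> R)
    (a : nat -> option 'I_n) : R :=
  (a 0%N == Some x)%:R * \prod_(i < m) jump_prob Q (a i) (a i.+1) *
  \prod_(i < m.+1) (1 - dl i / (jump_rate Q (a i) + dl i)).

Lemma measurable_discounted_path m dl a :
  measurable_fun setT (discounted_path m dl a).
Proof.
rewrite /discounted_path.
apply: measurable_funM; apply: measurable_prod => i _.
  exact: measurable_discount_holding.
exact: measurable_chain_indic.
Qed.

Lemma discounted_path_ge0_le1 m dl a w : (forall i, 0 <= dl i) ->
  0 <= discounted_path m dl a w <= 1.
Proof.
move=> dl0; apply/andP; split.
  by apply: mulr_ge0; apply: prodr_ge0 => i _; rewrite ?discount_ge0.
apply: mulr_ile1; try (by apply: prodr_ge0 => i _; rewrite ?discount_ge0);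
  apply: prodr_ile1 => i _; first exact: discount_holding_ge0_le1.
by rewrite ler0n lern1 leq_b1.
Qed.

Lemma integral_discounted_path x m dl a : (forall i, 0 <= dl i) ->
  (\int[P x]_w (discounted_path m dl a w)%:E)%E =
  (discounted_path_prob x m dl a)%:E.
Proof.
move=> dl0; rewrite /discounted_path_prob.
have := @mixed_law x m a dl m.+1 (fun=> 0) (leqnn _) dl0 (fun=> lexx _).
rewrite (eq_bigr (fun i : 'I_m.+1 => 1 - dl i / (jump_rate Q (a i) + dl i))).
  move=> <-; apply: eq_integral => w _; congr EFin.
  rewrite /discounted_path -big_split/=; apply: eq_bigr => i _.
  by rewrite /factor ltn_ord.
by move=> i _; rewrite ltn_ord.
Qed.

Lemma integral_sum_discounted_path (I : finType) x m (k : I -> R)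
    (dl : I -> nat -> R) (a : I -> nat -> option 'I_n) :
  (forall p i, 0 <= dl p i) ->
  (\int[P x]_w (\sum_p k p * discounted_path m (dl p) (a p) w)%:E)%E =
  (\sum_p k p * discounted_path_prob x m (dl p) (a p))%:E.
Proof.
move=> dl0.
have intp p : (P x).-integrable setT
    (EFin \o discounted_path m (dl p) (a p)).
  apply: (@bounded_integrable_prob _ _ _ _ _ 1).
    exact: measurable_discounted_path.
  by move=> w; have /andP[? ?] := discounted_path_ge0_le1 m (a p) w (dl0 p);
    rewrite ger0_norm.
transitivity (\int[P x]_w (\sum_p
    ((k p)%:E * (discounted_path m (dl p) (a p) w)%:E)))%E.
  by apply: eq_integral => w _; rewrite -sumEFin.
rewrite integral_sum//; last by move=> p; apply: integrableZl => //; exact: intp.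
rewrite -sumEFin; apply: eq_bigr => p _.
by rewrite integralZl// ?integral_discounted_path//; exact: intp.
Qed.

(** Reduces functions of the random path to finitely many fixed paths, exactly one of which is
    followed. *)
Lemma path_decomposition m w
    (F : {ffun 'I_m.+1 -> option 'I_n} -> R) :
  F [ffun i => jump_chain X (val i) w] =
  \sum_(g : {ffun 'I_m.+1 -> option 'I_n})
    F g * \prod_(i < m.+1) (jump_chain X i w == g (inord i))%:R.
Proof.
rewrite -(sum_indic_eq F); apply: eq_bigr => g _; congr (_ * _).
rewrite prod_boolr; congr (nat_of_bool _)%:R; apply/eqP/forallP.
  by move=> <- i; rewrite ffunE inord_val.
by move=> gi; apply/ffunP => i; rewrite ffunE; have /eqP := gi i; rewrite inord_val.
Qed.

(** * The discounted martingale *)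

Section martingale.
Context {d h : 'I_n -> R}.
Hypothesis hd : forall u, 0 <= d u.
Hypothesis hQ0 : forall u, Q u u < 0.
Hypothesis hh : forall y, (d y - Q y y) * h y =
  \sum_(z | z != y) Q y z * h z - \sum_u Q y u.

Let dd (a : option 'I_n) := oapp d 0 a.
Let ext (a : option 'I_n) := oapp h 1 a.

(** Meant as the conditional expectation of the full discount given the first [m] transitions. *)
Definition discounted_value m w : R :=
  \prod_(i < m) discount (dd (jump_chain X i w)) (holding_time X i w) *
  ext (jump_chain X m w).

Let dd_ge0 a : 0 <= dd a. Proof. by case: a => /=. Qed.

(* [h] is harmonic for the jump chain discounted at the holding times. *)
Lemma one_step a : (1 - dd a / (jump_rate Q a + dd a)) *
  (\sum_b jump_prob Q a b * ext b) = ext a.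
Proof.
case: a => [y|] /=; last first.
  rewrite mul0r subr0 mul1r -[RHS](sum_indic_eq ext None).
  by apply: eq_bigr => b _; rewrite eq_sym mulrC.
have q0 : Q y y != 0 by rewrite lt_eqF.
have dq0 : - Q y y + d y != 0.
  by rewrite gt_eqF// ltr_wpDr// oppr_gt0.
(* The sum splits into the cemetery, [y] itself, which has probability 0, and the other states. *)
rewrite (negbTE q0) (bigD1 None)//= (reindex_omap Some id)/=; last first.
  by case.
rewrite [X in _ * 1 + X](bigD1 y)/=; last by rewrite ?eqxx.
rewrite eqxx mul0r add0r [X in _ * 1 + X](eq_big (fun z => z != y)
  (fun z => - (Q y y)^-1 * (Q y z * h z))); last 2 first.
- by move=> z; rewrite eqxx.
- by move=> z /andP[_ /negbTE ->]; field.
rewrite -mulr_sumr mulr1; set S := \sum_(z | z != y) _; set r := \sum_(u < n) _.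
have e : S = (d y - Q y y) * h y + r by rewrite hh -/S -/r subrK.
by rewrite e; field; rewrite q0 dq0.
Qed.

Let steps m (g : {ffun 'I_m.+1 -> option 'I_n}) (i : nat) : option 'I_n :=
  g (inord i).
(** Rate 0 from index [m] on: the [m]-th holding time does not enter [discounted_value m]. *)
Let rate m (a : nat -> option 'I_n) (i : nat) :=
  if (i < m)%N then dd (a i) else 0.
Let stepsS m (p : {ffun 'I_m.+1 -> option 'I_n} * option 'I_n)
    (i : nat) : option 'I_n :=
  if (i < m.+1)%N then steps p.1 i else p.2.

Let stepsS_lt m (g : {ffun 'I_m.+1 -> option 'I_n}) b i : (i < m.+1)%N ->
  stepsS (g, b) i = steps g i.
Proof. by rewrite /stepsS => ->. Qed.

Let stepsS_last m (g : {ffun 'I_m.+1 -> option 'I_n}) b :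
  stepsS (g, b) m.+1 = b.
Proof. by rewrite /stepsS ltnn. Qed.

Let rate_ge0 m a i : 0 <= rate m a i.
Proof. by rewrite /rate; case: ifP. Qed.

Let discounted_path_rate m a w : discounted_path m (rate m a) a w =
  \prod_(i < m) discount (dd (a i)) (holding_time X i w) *
  \prod_(i < m.+1) (jump_chain X i w == a i)%:R.
Proof.
rewrite /discounted_path big_ord_recr/= {2}/rate ltnn discount0 mulr1.
by congr (_ * _); apply: eq_bigr => i _; rewrite /rate ltn_ord.
Qed.

Let discounted_path_prob_rate x m a :
  discounted_path_prob x m (rate m a) a =
  (a 0%N == Some x)%:R * \prod_(i < m) jump_prob Q (a i) (a i.+1) *
  \prod_(i < m) (1 - dd (a i) / (jump_rate Q (a i) + dd (a i))).
Proof.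
rewrite /discounted_path_prob big_ord_recr/= {2 3}/rate ltnn mul0r subr0 mulr1.
by congr (_ * _); apply: eq_bigr => i _; rewrite /rate ltn_ord.
Qed.

Lemma discounted_value_paths m w : discounted_value m w =
  \sum_(g : {ffun 'I_m.+1 -> option 'I_n}) ext (steps g m) *
    discounted_path m (rate m (steps g)) (steps g) w.
Proof.
have := @path_decomposition m w (fun g : {ffun 'I_m.+1 -> option 'I_n} =>
  ext (steps g m) *
  \prod_(i < m) discount (dd (steps g i)) (holding_time X i w)).
rewrite [X in X = _ -> _](_ : _ = discounted_value m w).
  by move=> ->; apply: eq_bigr => g _; rewrite discounted_path_rate mulrA.
rewrite /discounted_value mulrC /steps ffunE/= inordK//; congr (_ * _).
by apply: eq_bigr => i _; rewrite ffunE/= inordK// ltnS ltnW.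
Qed.

(** The last state is kept apart from the rest of the path, so that it can be summed out alone. *)
Lemma discounted_value_paths_succ m w : discounted_value m.+1 w =
  \sum_(p : {ffun 'I_m.+1 -> option 'I_n} * option 'I_n)
    ext p.2 * discounted_path m.+1
    (rate m.+1 (stepsS p)) (stepsS p) w.
Proof.
have := @path_decomposition m w (fun g : {ffun 'I_m.+1 -> option 'I_n} =>
  \sum_b ext b *
  (jump_chain X m.+1 w == b)%:R *
  \prod_(i < m.+1) discount (dd (steps g i)) (holding_time X i w)).
rewrite [X in X = _ -> _](_ : _ = discounted_value m.+1 w).
  move=> ->; under eq_bigr do rewrite mulr_suml; rewrite pair_bigA/=.
  apply: eq_bigr => -[g b] _; rewrite discounted_path_rate/=.
  rewrite [\prod_(i < m.+2) _]big_ord_recr/= stepsS_last.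
  rewrite [in RHS](eq_bigr (fun i : 'I_m.+1 =>
    discount (dd (steps g i)) (holding_time X i w))); last first.
    by move=> i _; rewrite stepsS_lt.
  rewrite [\prod_(i < m.+1) (jump_chain X i w == stepsS _ i)%:R](eq_bigr
    (fun i : 'I_m.+1 => (jump_chain X i w == g (inord i))%:R)); last first.
    by move=> i _; rewrite stepsS_lt.
  set p := \prod_(i < _) discount _ _; set q := \prod_(i < _) _; ring.
rewrite -mulr_suml sum_indic_eq mulrC; congr (_ * _).
by apply: eq_bigr => i _; rewrite /steps ffunE/= inordK.
Qed.

Lemma integral_discounted_value x m :
  (\int[P x]_w (discounted_value m w)%:E)%E = (h x)%:E.
Proof.
elim: m => [|m <-].
  transitivity (\int[P x]_w (\sum_b ext b *
      discounted_path 0 (fun=> 0) (fun=> b) w)%:E)%E.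
    apply: eq_integral => w _; rewrite /discounted_value big_ord0 mul1r.
    congr EFin; rewrite -(sum_indic_eq ext); apply: eq_bigr => b _.
    by rewrite /discounted_path !big_ord1 discount0 mul1r.
  rewrite integral_sum_discounted_path//; congr EFin.
  rewrite -[RHS](sum_indic_eq ext (Some x)); apply: eq_bigr => b _.
  rewrite /discounted_path_prob big_ord0 big_ord1 mul0r subr0 !mulr1.
  by rewrite eq_sym.
under eq_integral do rewrite discounted_value_paths_succ.
rewrite integral_sum_discounted_path//.
under [in RHS]eq_integral do rewrite discounted_value_paths.
rewrite integral_sum_discounted_path//; congr EFin.
rewrite -(pair_bigA _ (fun (g : {ffun 'I_m.+1 -> option 'I_n}) b =>
  ext b * discounted_path_prob x m.+1
  (rate m.+1 (stepsS (g, b))) (stepsS (g, b))))/=.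
(* For a fixed path [g], harmonicity at its last state absorbs the discount there and the jump to
   [b]. *)
apply: eq_bigr => g _; rewrite -one_step mulr_sumr mulr_suml.
apply: eq_bigr => b _; rewrite !discounted_path_prob_rate !big_ord_recr/=.
rewrite stepsS_last !stepsS_lt//.
rewrite (eq_bigr (fun i : 'I_m =>
  jump_prob Q (steps g i) (steps g i.+1))); last first.
  by move=> i _; rewrite !stepsS_lt ?ltnS ?(ltnW (ltn_ord i)).
rewrite [\prod_(i < m) (1 - _ / (jump_rate Q (stepsS _ i) + _))](eq_bigr
  (fun i : 'I_m => 1 - dd (steps g i) /
     (jump_rate Q (steps g i) + dd (steps g i)))); last first.
  by move=> i _; rewrite stepsS_lt// ltnS ltnW.
set p := \prod_(i < m) _; set q := \prod_(i < m) _; ring.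
Qed.

End martingale.

(** * Almost sure absorption and passage to the limit *)

(** The cemetery has rate 0, so discounting its holding time at rate 1 yields the factor
    [1 - 1 / (0 + 1) = 0]. A nonnegative variable of mean 0 vanishes almost surely, and [exp (- H)]
    vanishes only for [H = +oo]. *)
Lemma ae_cemetery_absorbing x : {ae P x, forall w, forall k,
  jump_chain X k w = None -> holding_time X k w = +oo%E}.
Proof.
apply: ae_foralln => k.
pose dl (i : nat) : R := (i == k)%:R.
pose F w := discount 1 (holding_time X k w) * (jump_chain X k w == None)%:R.
have FE w : F w = \sum_(g : {ffun 'I_k.+1 -> option 'I_n})
    (g (inord k) == None)%:R *
    discounted_path k dl (fun i => g (inord i)) w.
  have := @path_decomposition k w (fun g => (g (inord k) == None)%:R *
    discount 1 (holding_time X k w)).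
  rewrite ffunE/= inordK// [X in X = _ -> _]mulrC -/(F w) => ->.
  apply: eq_bigr => g _; rewrite -mulrA /discounted_path; congr (_ * (_ * _)).
  rewrite big_ord_recr/= /dl eqxx big1 ?mul1r// => i _.
  by rewrite ltn_eqF ?ltn_ord// discount0.
have F0 w : 0 <= F w by rewrite mulr_ge0// discount_ge0.
have mF : measurable_fun setT F.
  rewrite /F; apply: measurable_funM; last exact: measurable_chain_indic.
  exact: measurable_discount_holding.
have intF : (\int[P x]_w `|(F w)%:E| = 0)%E.
  transitivity (\int[P x]_w (F w)%:E)%E.
    by apply: eq_integral => w _; rewrite gee0_abs// lee_fin.
  under eq_integral do rewrite FE.
  rewrite integral_sum_discounted_path; last by move=> _ i; rewrite ler0n.
  rewrite big1// => g _; have [gk|] := eqVneq (g (inord k)) None; last first.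
    by rewrite mul0r.
  rewrite mul1r /discounted_path_prob big_ord_recr/= gk /dl eqxx/=.
  by rewrite add0r divr1 subrr !mulr0.
have mEF : measurable_fun setT (EFin \o F) by exact/measurable_EFinP.
have := (ae_eq_integral_abs (P x) measurableT mEF).1 intF.
apply: filterS => w /(_ I)/= [] /eqP.
rewrite /F mulf_eq0 => /orP[/eqP dk0 _|+ Ck]; last first.
  by rewrite Ck eqxx oner_eq0.
have := holding_time_gt0 hr k w.
move: dk0; rewrite /discount mul1e.
case: (holding_time X k w) => [r /eqP||]//=.
by rewrite expR_eq0.
Qed.

Lemma ae_finite_lifetime x :
  P x [set w | (transitions_before_death X w < +oo)%E] = 1%E ->
  {ae P x, forall w, exists k, jump_chain X k w = None}.
Proof.
have -> : [set w | (transitions_before_death X w < +oo)%E] =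
    \bigcup_k [set w | jump_chain X k.+1 w = None].
  apply/seteqP; split=> w /=.
    by move=> /ereal_inf_lt[_ [k Ck _] _]; exists k.
  move=> [k _ Ck]; apply: le_lt_trans (ltry k%:R).
  by apply: ereal_inf_lbound; exists k.
set E := \bigcup_k _ => E1.
have mE : measurable E.
  by apply: bigcupT_measurable => k; exact: measurable_jump_chain.
exists (~` E); split; first exact: measurableC.
  by rewrite (probability_setC (P x) mE) E1 subee.
by move=> w /= nC [k _ Ck]; apply: nC; exists k.+1.
Qed.

Lemma discounted_lifetime_expectation (d h : 'I_n -> R) x :
  (forall u, 0 <= d u) -> (forall u, Q u u < 0) ->
  (forall y, (d y - Q y y) * h y =
    \sum_(z | z != y) Q y z * h z - \sum_u Q y u) ->
  P x [set w | (transitions_before_death X w < +oo)%E] = 1%E ->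
  (\int[P x]_w
     (fine (expeR (- \sum_(u < n) (d u)%:E * total_time X u w)))%:E)%E =
  (h x)%:E.
Proof.
move=> hd hQ0 hh heta.
(* Bounds [h] and its value 1 at the cemetery; as discounts are at most 1, it dominates the whole
   sequence. *)
pose M := 1 + \sum_y `|h y|.
have extM a : `|oapp h 1 a| <= M.
  case: a => [y|] /=.
    by rewrite /M (bigD1 y)//= addrCA lerDl addr_ge0// sumr_ge0.
  by rewrite normr1 /M lerDl sumr_ge0.
have dd0 a : 0 <= oapp d 0 a by case: a => /=.
have mext k : measurable_fun setT
    (fun w => oapp h 1 (jump_chain X k w)).
  under eq_fun do rewrite -(sum_indic_eq (fun a => oapp h 1 a)).
  apply: measurable_sum => b; apply: measurable_funM => //.
  exact: measurable_chain_indic.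
have mZ m : measurable_fun setT (discounted_value (d := d) (h := h) m).
  rewrite /discounted_value; apply: measurable_funM => //.
  apply: measurable_prod => i _.
  under eq_fun do rewrite -(sum_indic_eq (fun a =>
     discount (oapp d 0 a) (holding_time X i _))).
  apply: measurable_sum => b; apply: measurable_funM.
    exact: measurable_discount_holding.
  exact: measurable_chain_indic.
have ZM m w : `|discounted_value (d := d) (h := h) m w| <= M.
  rewrite normrM -[M]mul1r ler_pM//.
  rewrite ger0_norm; last by apply: prodr_ge0 => i _; rewrite discount_ge0.
  by apply: prodr_ile1 => i _; exact: discount_holding_ge0_le1.
have mPhi : measurable_fun setT (fun w =>
    fine (expeR (- \sum_(u < n) (d u)%:E * total_time X u w)%E)).
  apply: measurableT_comp => //; apply: measurableT_comp.
    exact: measurable_expeR.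
  apply: measurableT_comp => //; apply: emeasurable_sum => u.
  by apply: measurable_funeM; exact: measurable_total_time.
set Phi := (fun w => fine _) in mPhi.
(* From the absorption index [K] on the sequence is constant: the further discounts have rate 0 and
   the value at the cemetery is 1. *)
have cvgPhi : {ae P x, forall w, setT w ->
    (discounted_value (d := d) (h := h) m w)%:E @[m --> \oo] --> (Phi w)%:E}.
  move: (ae_cemetery_absorbing x) (ae_finite_lifetime heta).
  apply: filterS2 => w Habs [k0 Ck0] _.
  have [K [CK fK]] := first_death hr Ck0.
  have CKm := absorbed_jump_chain fK (Habs K CK).
  rewrite /Phi (discounted_lifetime hm hr d fK CK (Habs K CK)).
  apply: cvg_near_cst; exists K => // m /= Km.
  rewrite /discounted_value CKm// CK/= mulr1; congr EFin.
  rewrite -(big_mkord xpredT (fun i =>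
    discount (oapp d 0 (jump_chain X i w)) (holding_time X i w))).
  rewrite (big_cat_nat (leq0n K) Km)//= big_mkord.
  rewrite [X in _ * X]big1_seq ?mulr1// => i.
  rewrite mem_index_iota => /andP[_ /andP[Ki _]].
  by rewrite CKm// CK/= discount0.
have [_ _ cvgZ] := @dominated_convergence _ _ _ (P x) setT measurableT
  (fun m => EFin \o discounted_value (d := d) (h := h) m) (EFin \o Phi)
  (fun=> M%:E) (fun m => iffRL (measurable_EFinP _ _) (mZ m))
  (iffRL (measurable_EFinP _ _) mPhi) cvgPhi
  (finite_measure_integrable_cst (P x) M measurableT)
  (aeW _ (fun w m _ => ZM m w)).
have Zh m : (\int[P x]_w (EFin \o discounted_value (d := d) (h := h) m) w =
    (h x)%:E)%E by exact: integral_discounted_value.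
rewrite -(cvg_lim _ cvgZ)//; apply: cvg_lim => //.
by under eq_fun do rewrite Zh; exact: cvg_cst.
Qed.

End killed_process.

(** * Conclusion by Cramer's rule *)

Lemma unit_detN_neq0 (R : realType) (n : nat) (Q : 'M[R]_n) :
  Q \in unitmx -> \det (- Q) != 0.
Proof.
rewrite -scaleN1r detZ unitmxE unitfE => Q0.
by rewrite mulf_neq0// expf_neq0// oppr_eq0 oner_eq0.
Qed.

Unset Implicit Arguments.

(* [total_time] may be +oo, but the exponential always lies in [0, 1], so that
   [fine] loses nothing. *)
Theorem mainTheorem3 (R : realType) (n : nat) (Q : 'M[R]_n)
    (disp : measure_display) (T : measurableType disp)
    (P : 'I_n -> probability T R) (X : R -> T -> option 'I_n)
    (hQ : subMarkov_generator Q)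
    (hX : is_killed_Markov_process Q P X)
    (hinv : Q \in unitmx)
    (heta : forall x : 'I_n,
       P x [set w | (transitions_before_death X w < +oo)%E] = 1%E)
    (x : 'I_n) (d : 'I_n -> R) (hd : forall u, 0 <= d u) :
  let D : 'M[R]_n := diag_mx (\row_u d u) in
  'E_(P x)[fun w => fine (expeR (- \sum_(u < n) (d u)%:E * total_time X u w))]%E =
  (\det (- Q) / \det (D - Q) *
   \sum_(y < n) (signed_minor (D - Q) x y / \det (- Q) *
                 (- \sum_(u < n) Q y u)))%:E.
Proof.
move=> D; have DQ : D - Q \in unitmx by exact: resolvent_unitmx.
pose r : 'cV[R]_n := \col_y - \sum_u Q y u.
pose h y := (invmx (D - Q) *m r) y 0.
rewrite unlock (discounted_lifetime_expectation hQ hX (h := h))//.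
- congr EFin; rewrite /h mxE [in RHS]mulr_sumr; apply: eq_bigr => y _.
  (* The inverse is the adjugate over the determinant; the adjugate transposes the cofactors, which
     matches [signed_minor], and [\det (- Q)] cancels. *)
  rewrite !mxE /invmx DQ !mxE /signed_minor.
  have detQ := unit_detN_neq0 hinv.
  by field; rewrite detQ/= -unitfE -unitmxE.
- by move=> u; exact: generator_diag_lt0.
- move=> y.
  have e : (D - Q) y y * h y + \sum_(z | z != y) (D - Q) y z * h z =
           - \sum_u Q y u.
    have /matrixP/(_ y 0) := mulKVmx DQ r.
    by rewrite mxE (bigD1 y)//= [in X in _ = X -> _]mxE.
  (* Off the diagonal [D - Q] equals [- Q], so the two sums over [z] cancel. *)
  rewrite -e addrCA -big_split/= big1 ?addr0 => [|z zy].
    by rewrite !mxE eqxx mulr1n.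
  rewrite !mxE eq_sym (negbTE zy) mulr0n; ring.
Qed.
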